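(* For every integer $n\geq 3$, the perfect Italian domination number of the Sierpi\'{n}ski graph $S(K_n,t)$ is \[ \gamma_I^p(S(K_n,t)) = \begin{cases} 2n-1, & t=2,\\ n^{t-2}(2n-2), & t\geq 3.\end{cases} \]
   Context: Sierpi\'{n}ski graph: for $n\ge 2$ and a positive integer $t$, $S(K_n,t)$ has as vertex set the set of words $u=u_1u_2\cdots u_t$ of length $t$ over the alphabet $V(K_n)=\{v_1,\dots,v_n\}$; two words $u,v$ are adjacent if and only if there is $i\in\{1,\dots,t\}$ such that $u_j=v_j$ for $j<i$, $u_i\neq v_i$, and $u_j=v_i$ and $v_j=u_i$ for all $j>i$. A perfect Italian dominating function (PID-function) of a graph $G$ is a function $f:V(G)\to\{0,1,2\}$ such that every vertex $v$ with $f(v)=0$ satisfies $\sum_{u\in N(v)} f(u)= 2$ exactly, where $N(v)$ is the open neighbourhood of $v$. The weight of $f$ is $\sum_{v\in V(G)} f(v)$, and the perfect Italian domination number $\gamma_I^p(G)$ is the minimum weight of a PID-function of $G$. *)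

(* Defs.v *)
From mathcomp Require Import all_boot.
Set Implicit Arguments.
Unset Strict Implicit.
Unset Printing Implicit Defensive.

(* Letters v_1, ..., v_n and positions 1, ..., t are both numbered from 0. *)
Definition sierpinski (n t : nat) : rel (t.-tuple 'I_n) :=
  fun u v => [exists i : 'I_t,
    [&& [forall j : 'I_t, (j < i) ==> (tnth u j == tnth v j)],
        tnth u i != tnth v i
      & [forall j : 'I_t, (i < j) ==>
          (tnth u j == tnth v i) && (tnth v j == tnth u i)]]].

Lemma sierpinski_sym n t : symmetric (@sierpinski n t).
Proof.
move=> u v; apply: eq_existsb => i; congr [&& _, _ & _].
- by apply: eq_forallb => j; rewrite eq_sym.
- by rewrite eq_sym.
- by apply: eq_forallb => j; rewrite andbC.
Qed.

Lemma sierpinski_irr n t : irreflexive (@sierpinski n t).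
Proof. by move=> u; apply/existsP => -[i] /and3P[_]; rewrite eqxx. Qed.

Section PerfectItalianDomination.
Variables (V : finType) (e : rel V).

Definition pid_fun (f : {ffun V -> 'I_3}) : bool :=
  [forall v, (f v == 0 :> nat) ==> (\sum_(u | e v u) f u == 2)].

Definition weight (f : {ffun V -> 'I_3}) : nat := \sum_v f v.

Lemma pid_fun_const2 : pid_fun [ffun=> ord_max].
Proof. by apply/forallP => v; rewrite ffunE. Qed.

(* The seed of the arg min satisfies pid_fun, so this is a true minimum. *)
Definition perfect_italian_number : nat :=
  weight [arg min_(f < [ffun=> ord_max] | pid_fun f) weight f].

Lemma perfect_italian_numberP :
  (exists2 f, pid_fun f & weight f = perfect_italian_number) /\
  (forall f, pid_fun f -> perfect_italian_number <= weight f).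
Proof.
rewrite /perfect_italian_number.
by case: arg_minnP => [|f Pf fmin]; [exact: pid_fun_const2 | split; [exists f|]].
Qed.

End PerfectItalianDomination.

(* Main.v *)
Require Import Defs.
From mathcomp Require Import all_boot.
From mathcomp Require Import zify.

(** Cut S(K_n,t) into n^(t-2) blocks S(K_n,2), each made of n cliques K_n. Apart
    from its clique, a vertex has at most one further neighbour.

    In a block, a clique of weight 0 forces weight at least 2 on every other
    clique, and a clique i of weight 1 forces value 1 on at least n-2 of the
    vertices ji. Counting these columns shows that a block weighs at least 2n-2
    when n >= 4. For n = 3 a block may weigh only 3, but then its three extreme
    vertices have value 0 and need an outside neighbour of value 1. In general
    3 w + d >= 12 + s, where w is the weight of the block, d counts the extreme
    vertices of value 0 with outside neighbour of value 1 and s those of value 1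
    with outside neighbour of value 0. Summed over all blocks, d and s cancel
    along each edge between blocks. For t = 2 no vertex ii has an outside
    neighbour, so no clique has weight 0 and at most one has weight 1.

    For t >= 3 the bound is attained by arranging the blocks ym (m a letter) along
    the directed cycles m -> m+1 of the lowest-level cliques of blocks: block m
    takes the value 1 on its extreme vertex facing block m+1 and 0 on the one
    facing block m-1. *)
Set Implicit Arguments.
Unset Strict Implicit.
Unset Printing Implicit Defensive.

(** * Recursive structure of S(K_n,t) along the first letter *)

Section Words.
Variable n : nat.
Implicit Types (x y k : 'I_n) (h : 'I_n -> nat).

Definition extreme t k : t.-tuple 'I_n := [tuple of nseq t k].

Lemma big_tuple_cons t (P : pred (t.+1.-tuple 'I_n)) (F : t.+1.-tuple 'I_n -> nat) :
  \sum_(u | P u) F u =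
  \sum_x \sum_(u : t.-tuple 'I_n | P [tuple of x :: u]) F [tuple of x :: u].
Proof.
rewrite pair_big_dep /=.
rewrite (reindex (fun p : 'I_n * t.-tuple 'I_n => [tuple of p.1 :: p.2])) //=.
exists (fun u : t.+1.-tuple 'I_n => (thead u, [tuple of behead u])) => [[x u]|u] _ /=.
  by congr pair; apply: val_inj.
by rewrite -tuple_eta.
Qed.

Lemma cons_tuple_eq t x y (u v : t.-tuple 'I_n) :
  ([tuple of x :: u] == [tuple of y :: v]) = (x == y) && (u == v).
Proof. by rewrite -!val_eqE /= eqseq_cons. Qed.

Lemma extremeS t k : extreme t.+1 k = [tuple of k :: extreme t k].
Proof. exact: val_inj. Qed.

(** If the first letters differ, the deciding position must be the first one, which forces all later
    letters; otherwise it lies in the tails. Every induction on [t] rests on this. *)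
Lemma sierpinski_cons t x y (u v : t.-tuple 'I_n) :
  sierpinski [tuple of x :: u] [tuple of y :: v] =
  if x == y then sierpinski u v else (u == extreme t y) && (v == extreme t x).
Proof.
apply/existsP/idP => [[i]|].
  case: (unliftP ord0 i) => [j|] -> /and3P[/forallP eq_before neq /forallP after].
    have /eqP exy : x == y by have := eq_before ord0; rewrite !tnth0.
    rewrite exy eqxx; apply/existsP; exists j; move: neq; rewrite !tnthS => neq.
    apply/and3P; split => //; apply/forallP => k.
      by have := eq_before (lift ord0 k); rewrite !tnthS.
    by have := after (lift ord0 k); rewrite !tnthS.
  move: neq; rewrite !tnth0 => /negPf ->.
  apply/andP; split; apply/eqP/eq_from_tnth => k;
    have := after (lift ord0 k);
    by rewrite !tnth0 !tnthS tnth_nseq => /andP[/eqP ? /eqP ?].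
case: eqVneq => [-> /existsP[j /and3P[/forallP eq_before neq /forallP after]]|neq].
  exists (lift ord0 j); rewrite !tnthS neq; apply/and3P; split => //; apply/forallP => k;
    case: (unliftP ord0 k) => [l|] ->; rewrite ?tnth0 ?tnthS ?eqxx ?implybT //.
    exact: eq_before.
  exact: after.
case/andP=> /eqP-> /eqP->; exists ord0; rewrite !tnth0 neq; apply/and3P; split => //.
  by apply/forallP.
apply/forallP => k; case: (unliftP ord0 k) => [l|] ->; rewrite ?tnth0 ?tnthS //.
by rewrite !tnth_nseq !eqxx implybT.
Qed.

(* [h k] is the value outside the graph that is seen from the extreme vertex k...k.
   [outer f h x] gives the values seen from the copy of S(K_n,t) formed by the
   words that start with x. *)
Definition outer t (f : t.+1.-tuple 'I_n -> nat) h x : 'I_n -> nat :=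
  fun k => if k == x then h x else f [tuple of k :: extreme t x].

Definition italian_sum t (f : t.-tuple 'I_n -> nat) h (u : t.-tuple 'I_n) : nat :=
  \sum_(v | sierpinski u v) f v + \sum_(k | u == extreme t k) h k.

Lemma italian_sum_nil (f : 0.-tuple 'I_n -> nat) h (u : 0.-tuple 'I_n) :
  italian_sum f h u = \sum_k h k.
Proof.
rewrite /italian_sum big1 => [|v /existsP[[]] //].
by apply: eq_bigl => k; rewrite (tuple0 u) (tuple0 (extreme 0 k)) eqxx.
Qed.

(** An edge from xk...k out of copy [x] leads to kx...x, or outside the graph when [k = x]; [outer]
    records the value seen there, so the domination condition passes to each copy. *)
Lemma italian_sum_cons t (f : t.+1.-tuple 'I_n -> nat) h x (u : t.-tuple 'I_n) :
  italian_sum f h [tuple of x :: u] =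
  italian_sum (fun v => f [tuple of x :: v]) (outer f h x) u.
Proof.
rewrite /italian_sum big_tuple_cons (bigD1 x) //= -addnA; congr (_ + _).
  by apply: eq_bigl => v; rewrite sierpinski_cons eqxx.
rewrite [RHS]big_mkcond [RHS](bigD1 x) //= addnC; congr (_ + _).
  under eq_bigl do rewrite extremeS cons_tuple_eq.
  rewrite big_mkcond (bigD1 x) //= eqxx big1 ?addn0 => [|k /negPf nkx].
    by rewrite /outer eqxx.
  by rewrite eq_sym nkx.
apply: eq_bigr => y /negPf nyx; rewrite /outer nyx.
under eq_bigl do rewrite sierpinski_cons eq_sym nyx.
case: eqP => [_|_]; last by rewrite big_pred0.
by rewrite (big_pred1 (extreme t x)).
Qed.

End Words.

(** * Weight of a single block S(K_n,2) *)

Section Block.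
Variables (n : nat) (g : 'I_n -> 'I_n -> nat) (h : 'I_n -> nat).

(** Here [g a b] stands for the value at the word ab. Since that value is 0, the whole row sum is
    the sum over the rest of its clique. *)
Definition block_italian : Prop := forall a b, g a b = 0 ->
  \sum_c g a c + (if b == a then h a else g b a) = 2.

Hypothesis gP : block_italian.

(** For [a != i] the vertex ia has value 0 and sees only zeros in its clique, so its linked vertex
    ai has value 2. *)
Lemma block_weight_zero_row i :
  \sum_c g i c = 0 -> 2 * n - 2 <= \sum_a \sum_c g a c.
Proof.
move=> row0; rewrite (bigD1 i) //= row0.
have -> : 2 * n - 2 = \sum_(a | a != i) 2.
  rewrite sum_nat_const (eq_card (B := predC1 i)) // cardC1 card_ord; lia.
apply: leq_sum => a /negPf nai.
have gi0 : g i a = 0 by move: row0; rewrite (bigD1 a) //=; lia.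
by have := gP gi0; rewrite row0 nai (bigD1 i) //=; lia.
Qed.

(** For each [a != i], either ia takes the single unit of row [i], which happens at most once, or ia
    has value 0 and ai supplies the missing 1. *)
Lemma block_column_row1 i : \sum_c g i c = 1 -> n - 2 <= \sum_a g a i.
Proof.
move=> row1.
have : \sum_(a | a != i) 1 <= \sum_(a | a != i) (g a i + g i a).
  apply: leq_sum => a /negPf nai; case: (posnP (g i a)) => [gi0|]; last lia.
  by have := gP gi0; rewrite row1 nai; lia.
rewrite sum_nat_const (eq_card (B := predC1 i)) // cardC1 card_ord big_split /=.
rewrite (bigD1 i) //= in row1; rewrite [X in _ -> _ <= X](bigD1 i) //=; lia.
Qed.

Lemma block_weight_row1 : (forall i, \sum_c g i c != 0) ->
  2 * n <= \sum_a \sum_c g a c + \sum_a (\sum_c g a c == 1).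
Proof.
move=> row_neq0; rewrite -big_split mulnC -{1}(card_ord n) -sum_nat_const.
by apply: leq_sum => a _; have := row_neq0 a; case: (\sum_c g a c) => [|[]].
Qed.

Lemma block_weight : 3 < n -> 2 * n - 2 <= \sum_a \sum_c g a c.
Proof.
move=> n_gt3; case: (pickP (fun i => \sum_c g i c == 0)) => [i /eqP|row_neq0].
  exact: block_weight_zero_row.
have := block_weight_row1 (fun i => negbT (row_neq0 i)).
set k := (X in _ <= _ + X) => le_2n.
have : k * (n - 2) <= \sum_a \sum_c g a c.
  rewrite [X in _ <= X]exchange_big /= /k big_distrl; apply: leq_sum => i _.
  by case: eqP => [/block_column_row1|]; rewrite /= ?mul1n.
(* Now w >= 2n - k and w >= k(n - 2): the first suffices for k <= 2, and for k >= 3 the second gives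
   3n - 6 >= 2n - 2, as n >= 4. *)
move: le_2n; set w := \sum_a (\sum_c _); nia.
Qed.

Lemma block_weight_isolated : 0 < n -> (forall k, h k = 0) ->
  2 * n - 1 <= \sum_a \sum_c g a c.
Proof.
move=> n_gt0 h0.
have diag i : g i i = 0 -> \sum_c g i c = 2 by move/gP; rewrite eqxx h0 addn0.
have row_neq0 i : \sum_c g i c != 0.
  apply/eqP => row0; have : g i i = 0 by move: row0; rewrite (bigD1 i) //=; lia.
  by move/diag; rewrite row0.
have row1_diag i : \sum_c g i c = 1 -> g i i = 1 /\ forall j, j != i -> g i j = 0.
  move=> row1; have g_gt0 : 0 < g i i by case: posnP => // /diag; rewrite row1.
  rewrite (bigD1 i) //= in row1; split; first lia.
  by move=> j nji; move: row1; rewrite (bigD1 j) //=; lia.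
(* If rows [i] and [j] both had their only unit on the diagonal, ji would have value 0, clique sum 1
   and linked value 0. *)
have : \sum_a (\sum_c g a c == 1) <= 1.
  case: (pickP (fun i => \sum_c g i c == 1)) => [i /eqP row1|no1]; last first.
    by rewrite big1 // => a _; rewrite no1.
  rewrite (bigD1 i) //= [X in _ + X]big1 ?addn0 ?leq_b1 // => j nji.
  apply/eqP; rewrite eqb0; apply/eqP => /row1_diag[gjj gj0].
  have nij : i != j by rewrite eq_sym.
  have := gP (gj0 i nij); rewrite (negPf nij).
  have [_ /(_ j nji) ->] := row1_diag i row1.
  by rewrite addn0 (bigD1 j) //= gjj big1.
by have := block_weight_row1 row_neq0; lia.
Qed.

End Block.

(* The nine values of [g], read row by row; [h] is eliminated by solving the
   condition on the diagonal zeros for it. *)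
Definition block3_check (a0 a1 a2 b0 b1 b2 c0 c1 c2 : nat) : bool :=
  let a := a0 + a1 + a2 in let b := b0 + b1 + b2 in let c := c0 + c1 + c2 in
  let off x r y := (x == 0) ==> (r + y == 2) in
  let diag x r := (x == 0) ==> (r <= 2) in
  let credit x r := ((x == 0) && (r == 1) : nat) in
  [&& off a1 a b0, off a2 a c0, off b0 b a1, off b2 b c1, off c0 c a2, off c1 c b2,
      diag a0 a, diag b1 b & diag c2 c] ==>
  (12 + ((a0 == 1) + (b1 == 1) + (c2 == 1))
   <= 3 * (a + b + c) + (credit a0 a + credit b1 b + credit c2 c)).

(** S(K_3,2) has nine vertices with three possible values each, so 3^9 cases are computed. *)
Lemma block3_checkP :
  all (fun a0 => all (fun a1 => all (fun a2 =>
  all (fun b0 => all (fun b1 => all (fun b2 =>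
  all (fun c0 => all (fun c1 => all (fun c2 =>
    block3_check a0 a1 a2 b0 b1 b2 c0 c1 c2)
  (iota 0 3)) (iota 0 3)) (iota 0 3)) (iota 0 3)) (iota 0 3)) (iota 0 3))
  (iota 0 3)) (iota 0 3)) (iota 0 3).
Proof. by vm_compute. Qed.

Lemma block3_weight n (g : 'I_n -> 'I_n -> nat) (h : 'I_n -> nat) :
  n = 3 -> block_italian g h -> (forall a b, g a b <= 2) ->
  3 * (2 * n - 2) + \sum_k ((g k k == 1) && (h k == 0)) <=
  3 * (\sum_a \sum_c g a c) + \sum_k ((g k k == 0) && (h k == 1)).
Proof.
move=> n3; subst n; move=> gP g_le2; have in3 a b : g a b \in iota 0 3 by rewrite mem_iota /= ltnS.
pose o0 : 'I_3 := ord0; pose o1 : 'I_3 := lift ord0 ord0.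
pose o2 : 'I_3 := lift ord0 (lift ord0 ord0).
have sum3 (F : 'I_3 -> nat) : \sum_k F k = F o0 + F o1 + F o2.
  by rewrite !big_ord_recl big_ord0 addn0 addnA.
have off a b : a != b -> (g a b == 0) ==> (g a o0 + g a o1 + g a o2 + g b a == 2).
  by move=> nab; apply/implyP=> /eqP /gP; rewrite eq_sym (negPf nab) sum3 => ->.
have diag a : (g a a == 0) ==> (g a o0 + g a o1 + g a o2 <= 2).
  by apply/implyP=> /eqP /gP; rewrite eqxx sum3 => <-; rewrite leq_addr.
have : block3_check (g o0 o0) (g o0 o1) (g o0 o2) (g o1 o0) (g o1 o1) (g o1 o2)
    (g o2 o0) (g o2 o1) (g o2 o2).
  have step P s (x : nat) : x \in s -> all P s -> P x by move=> xs /allP; apply.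
  have := block3_checkP.
  move/(step _ _ _ (in3 o0 o0))/(step _ _ _ (in3 o0 o1))/(step _ _ _ (in3 o0 o2)).
  move/(step _ _ _ (in3 o1 o0))/(step _ _ _ (in3 o1 o1))/(step _ _ _ (in3 o1 o2)).
  by move/(step _ _ _ (in3 o2 o0))/(step _ _ _ (in3 o2 o1))/(step _ _ _ (in3 o2 o2)).
rewrite /block3_check !off //= !diag /= => /leq_trans le_w.
(* The check does not see [h]: it charges every diagonal 1 as supply, and credits only diagonal
   zeros with row sum 1, where the condition forces [h a = 1]. *)
have supply a : (g a a == 1) && (h a == 0) <= (g a a == 1).
  by case: (g a a == 1); rewrite ?leq_b1.
have demand a : (g a a == 0) && (g a o0 + g a o1 + g a o2 == 1)
                <= (g a a == 0) && (h a == 1).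
  by case: eqP => [/gP|//]; rewrite eqxx sum3; lia.
rewrite !sum3; apply: leq_trans (le_w _ _).
  by rewrite leq_add2l !leq_add.
by rewrite leq_add2l !leq_add.
Qed.

(** * Summing the block bounds over the whole graph *)

Section LowerBound.
Variable n : nat.
Implicit Types (x y k : 'I_n) (h : 'I_n -> nat).

Lemma big_tuple0 (F : 0.-tuple 'I_n -> nat) : \sum_u F u = F [tuple].
Proof. by rewrite (big_pred1 [tuple]) // => u; apply/esym/eqP/tuple0. Qed.

Lemma big_tuple2 (F : 2.-tuple 'I_n -> nat) :
  \sum_u F u = \sum_a \sum_b F [tuple a; b].
Proof.
rewrite big_tuple_cons; apply: eq_bigr => a _.
rewrite big_tuple_cons; apply: eq_bigr => b _.
by rewrite big_tuple0; congr F; apply: val_inj.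
Qed.

Lemma italian_sum2 (f : 2.-tuple 'I_n -> nat) h a b :
  italian_sum f h [tuple a; b] =
  \sum_(c | c != b) f [tuple a; c] + (if b == a then h a else f [tuple b; a]).
Proof.
have -> : [tuple a; b] = [tuple of a :: [tuple of b :: [tuple]]] by apply: val_inj.
rewrite !italian_sum_cons italian_sum_nil (bigD1 b) //= addnC; congr (_ + _).
  apply: eq_bigr => c /negPf ncb; rewrite /outer ncb.
  by congr f; apply: val_inj.
rewrite /outer eqxx; case: eqP => // _.
by congr f; apply: val_inj.
Qed.

Definition extreme_count (p q : nat) t (f : t.-tuple 'I_n -> nat) h : nat :=
  \sum_k ((f (extreme t k) == p) && (h k == q)).

Definition linking_count (p q : nat) t (f : t.+1.-tuple 'I_n -> nat) : nat :=
  \sum_x \sum_(k | k != x) ((f [tuple of x :: extreme t k] == p)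
                         && (f [tuple of k :: extreme t x] == q)).

(** Each edge between two copies is counted from both ends, and swapping the ends swaps [p] and
    [q]. *)
Lemma linking_countC p q t (f : t.+1.-tuple 'I_n -> nat) :
  linking_count p q f = linking_count q p f.
Proof.
rewrite /linking_count; under eq_bigr do rewrite big_mkcond.
rewrite exchange_big; apply: eq_bigr => k _; rewrite [RHS]big_mkcond.
by apply: eq_bigr => x _; rewrite eq_sym andbC.
Qed.

(** Of the extreme vertices of copy [x], the one with [k = x] stays extreme in the whole graph; the
    others are ends of edges between copies. *)
Lemma extreme_count_cons p q t (f : t.+1.-tuple 'I_n -> nat) h :
  \sum_x extreme_count p q (fun u => f [tuple of x :: u]) (outer f h x) =
  extreme_count p q f h + linking_count p q f.
Proof.
rewrite -big_split; apply: eq_bigr => x _ /=.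
rewrite /extreme_count (bigD1 x) //= extremeS /outer eqxx; congr (_ + _).
by apply: eq_bigr => k /negPf ->.
Qed.

Definition italian t (f : t.-tuple 'I_n -> nat) h : Prop :=
  forall u, f u = 0 -> italian_sum f h u = 2.

Lemma italian_block (f : 2.-tuple 'I_n -> nat) h :
  italian f h -> block_italian (fun a b => f [tuple a; b]) h.
Proof.
move=> fP a b fab0; rewrite (bigD1 b) //= fab0 -italian_sum2.
exact: fP.
Qed.

(** The factor [n == 3] lets one induction serve both cases: for n > 3 each block meets the bound by
    itself, for n = 3 only with the correction of [block3_weight]. *)
Lemma italian_weight t (f : t.+2.-tuple 'I_n -> nat) h :
  3 <= n -> (forall u, f u <= 2) -> italian f h ->
  3 * (n ^ t * (2 * n - 2)) + (n == 3) * extreme_count 1 0 f h <=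
  3 * (\sum_u f u) + (n == 3) * extreme_count 0 1 f h.
Proof.
move=> n_ge3; elim: t f h => [|t IHt] f h f_le2 fP.
  have gP := italian_block fP; rewrite mul1n big_tuple2.
  case: eqP => [n3|n_neq3]; last first.
    rewrite !addn0 leq_mul2l (block_weight gP) // ltn_neqAle eq_sym n_ge3 andbT.
    exact/eqP.
  have extreme2 k : extreme 2 k = [tuple k; k] by apply: val_inj.
  rewrite /extreme_count; under eq_bigr do rewrite extreme2.
  under [X in _ <= _ + _ * X]eq_bigr do rewrite extreme2.
  by rewrite !mul1n; apply: block3_weight gP _.
have fxP x : italian (fun u => f [tuple of x :: u]) (outer f h x).
  by move=> u /fP; rewrite italian_sum_cons.
have := leq_sum (index_enum _) (fun x (_ : true) => IHt _ _ (fun u => f_le2 _) (fxP x)).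
rewrite [X in X <= _]big_split [X in _ <= X]big_split /= -!big_distrr /= sum_nat_const card_ord.
(* By symmetry the same linking count stands on both sides and cancels. *)
rewrite !extreme_count_cons big_tuple_cons [linking_count 1 0 f]linking_countC !mulnDr !addnA leq_add2r.
by rewrite expnS -mulnA mulnCA [n ^ t * (3 * _)]mulnCA [n ^ t * (n * _)]mulnCA.
Qed.

End LowerBound.

(** * Explicit functions that attain the bounds *)

Section UpperBound.
Variable n : nat.
Implicit Types (x y k m a b : 'I_n).

Lemma italian_perfect t (f : {ffun t.-tuple 'I_n -> 'I_3}) :
  pid_fun (@sierpinski n t) f <-> italian (fun u => f u : nat) (fun=> 0).
Proof.
have sum0 u : italian_sum (fun u => f u : nat) (fun=> 0) u = \sum_(v | sierpinski u v) f v.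
  by rewrite /italian_sum [X in _ + X]big1 ?addn0.
split=> [/forallP fP u fu0|fP]; first by rewrite sum0; apply/eqP/(implyP (fP u))/eqP.
by apply/forallP=> u; apply/implyP=> /eqP fu0; rewrite -sum0 fP.
Qed.

Lemma perfect_italian_number_le t (f : t.-tuple 'I_n -> nat) :
  (forall u, f u <= 2) -> italian f (fun=> 0) ->
  perfect_italian_number (@sierpinski n t) <= \sum_u f u.
Proof.
move=> f_le2 fP; have [_ min_le] := perfect_italian_numberP (@sierpinski n t).
pose F : {ffun t.-tuple 'I_n -> 'I_3} := [ffun u => inord (f u)].
have FE u : F u = f u :> nat by rewrite ffunE inordK // ltnS.
rewrite -(eq_bigr _ (fun u _ => FE u)); apply/min_le/italian_perfect => u.
rewrite FE => /fP fu2; apply: etrans fu2; congr (_ + _).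
by apply: eq_bigr => v _.
Qed.

Lemma sum_eq_ord k : \sum_c (c == k) = 1.
Proof. by rewrite (bigD1 k) //= eqxx big1 // => c /negPf ->. Qed.

Lemma sum_neq_ord k : \sum_c (c != k) = n - 1.
Proof.
have : \sum_(c < n) ((c == k) + (c != k)) = n.
  by under eq_bigr do rewrite addnC addn_negb; rewrite sum_nat_const card_ord muln1.
by rewrite big_split /= sum_eq_ord => /(canRL (addKn 1)).
Qed.

Lemma sierpinski2_upper a : perfect_italian_number (@sierpinski n 2) <= 2 * n - 1.
Proof.
(* Value 1 on the words ja and jj: clique [a] has weight 1, every other clique weight 2. The default
   of [nth] is never reached. *)
pose f (u : 2.-tuple 'I_n) : nat := (nth a u 1 == a) || (nth a u 0 == nth a u 1).
have row j : \sum_c f [tuple j; c] = 1 + (j != a).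
  rewrite -[X in _ = X + _](sum_eq_ord a); case: (eqVneq j a) => [->|nja] /=.
    by rewrite addn0; apply: eq_bigr => c _; rewrite /f /= eq_sym orbb.
  rewrite -[X in _ = _ + X](sum_eq_ord j) -big_split; apply: eq_bigr => c _; rewrite /f /= (eq_sym j).
  by case: (eqVneq c a) => // ->; rewrite (eq_sym a) (negPf nja).
have n_gt0 : 0 < n by apply: leq_ltn_trans (ltn_ord a).
have -> : 2 * n - 1 = \sum_u f u.
  rewrite big_tuple2 (eq_bigr _ (fun j _ => row j)) big_split /= sum_neq_ord.
  rewrite sum_nat_const card_ord; lia.
apply: perfect_italian_number_le => [u|u]; first exact: leq_trans (leq_b1 _) _.
case/tupleP: u => j u; case/tupleP: u => k u.
have -> : [tuple of j :: [tuple of k :: u]] = [tuple j; k].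
  by apply: val_inj; rewrite /= (tuple0 u).
rewrite italian_sum2 => fjk0; have := row j; rewrite (bigD1 k) //= fjk0 add0n => ->.
move/eqP: fjk0; rewrite /f /= eqb0 negb_or => /andP[_ /negPf njk].
by rewrite (eq_sym k) njk orbF; case: (j == a).
Qed.

(* The value of the vertex ab of the block with last letter m: the clique m-1 and
   the clique m+1 have weight 1, the other ones weight 2. *)
Definition cyclic_pattern m a b : bool :=
  (b == ordS m) || [&& b == ord_pred m, a != ord_pred m & a != ordS m].

Fixpoint last_three (u : seq 'I_n) : bool :=
  match u with
  | [::] => false
  | [:: m; a; b] => cyclic_pattern m a b
  | _ :: v => last_three v
  end.

Hypothesis n_ge3 : 3 <= n.

Lemma ordS_neq m : ordS m != m.
Proof.
rewrite -val_eqE /=; have := ltn_ord m.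
case: (ltngtP m.+1 n) => [ltn _|//|eqn _]; first by rewrite modn_small //; lia.
by rewrite eqn modnn; lia.
Qed.

Lemma ord_pred_neq m : ord_pred m != m.
Proof. by rewrite -{2}(ord_predK m) eq_sym ordS_neq. Qed.

(** Equality would mean m + 2 = m modulo [n], impossible for n >= 3. *)
Lemma ordS_pred_neq m : ordS m != ord_pred m.
Proof.
apply/eqP => eq_m; have := congr1 (@ordS n) eq_m.
rewrite ord_predK => /(congr1 val) /=; have := ltn_ord m; case: (ltngtP m.+1 n) => [lt1 _|//|eqn _].
  rewrite (@modn_small m.+1) //; case: (ltngtP m.+2 n) => [lt2||eqn]; last 2 first.
  - lia.
  - by rewrite eqn modnn; lia.
  by rewrite modn_small //; lia.
by rewrite eqn modnn modn_small; lia.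
Qed.

Lemma cyclic_pattern_row m a :
  \sum_c cyclic_pattern m a c = 1 + ((a != ord_pred m) && (a != ordS m)).
Proof.
rewrite -[X in _ = X + _](sum_eq_ord (ordS m)); case: (boolP (_ && _)) => [Pa|nPa].
  rewrite -[X in _ = _ + X](sum_eq_ord (ord_pred m)) -big_split; apply: eq_bigr => c _.
  rewrite /cyclic_pattern Pa andbT; case: (eqVneq c (ordS m)) => // ->.
  by rewrite (negPf (ordS_pred_neq m)).
by rewrite addn0; apply: eq_bigr => c _; rewrite /cyclic_pattern (negPf nPa) andbF orbF.
Qed.

Lemma cyclic_pattern_diag m : cyclic_pattern m m m = false.
Proof.
by rewrite /cyclic_pattern !(eq_sym m) (negPf (ordS_neq m)) (negPf (ord_pred_neq m)).
Qed.

Lemma last_three_cons t x (v : t.+3.-tuple 'I_n) : last_three (x :: v) = last_three v.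
Proof. by case/tupleP: v => ? v; case/tupleP: v => ? v; case/tupleP: v => ? v. Qed.

(** This makes copies of S(K_n,3) and larger ones see only zeros across the edges that join them, so
    [last_three_italian] reduces to S(K_n,3). *)
Lemma last_three_extreme t k : last_three (extreme t k) = false.
Proof.
elim: t => [|[|[|[|t]]] IHt] //; exact: cyclic_pattern_diag.
Qed.

Lemma last_three_weight t :
  \sum_(u : t.+3.-tuple 'I_n) last_three u = n ^ t.+1 * (2 * n - 2).
Proof.
elim: t => [|t IHt].
  have block m : \sum_(u : 2.-tuple 'I_n) last_three (m :: u) = 2 * n - 2.
    rewrite big_tuple2 (eq_bigr _ (fun a _ => cyclic_pattern_row m a)) big_split /=.
    have : \sum_a ((a != ord_pred m) && (a != ordS m)) + \sum_a (a == ordS m)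
      = \sum_a (a != ord_pred m).
      rewrite -big_split; apply: eq_bigr => a _ /=.
      by case: (eqVneq a (ordS m)) => [->|]; rewrite ?andbT ?addn0 // ordS_pred_neq.
    rewrite sum_eq_ord sum_neq_ord => /(canRL (addnK 1)) ->.
    rewrite sum_nat_const card_ord; lia.
  by rewrite big_tuple_cons (eq_bigr _ (fun m _ => block m)) sum_nat_const card_ord.
rewrite big_tuple_cons expnS -mulnA -IHt.
transitivity (\sum_(x < n) \sum_(u : t.+3.-tuple 'I_n) last_three u).
  by apply: eq_bigr => x _; apply: eq_bigr => u _; rewrite -(last_three_cons x u).
by rewrite sum_nat_const card_ord.
Qed.

Lemma last_three_italian t :
  italian (fun u : t.+3.-tuple 'I_n => last_three u : nat) (fun=> 0).
Proof.
elim: t => [|t IHt] u; last first.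
  case/tupleP: u => x u; rewrite italian_sum_cons.
  move=> last0; rewrite -(IHt u); last by rewrite -(last_three_cons x u).
  congr (_ + _); first by apply: eq_bigr => v _; rewrite -(last_three_cons x v).
  apply: eq_bigr => k _; rewrite /outer; case: eqP => // _.
  by rewrite (last_three_cons k (extreme t.+3 x)) last_three_extreme.
case/tupleP: u => m u; case/tupleP: u => a u; case/tupleP: u => b u.
have -> : [tuple of a :: [tuple of b :: u]] = [tuple a; b].
  by apply: val_inj; rewrite /= (tuple0 u).
rewrite italian_sum_cons italian_sum2 => /= mab0.
have := cyclic_pattern_row m a; rewrite (bigD1 b) //= mab0 add0n => ->.
move/eqP: mab0; rewrite eqb0 negb_or => /andP[nbS mab0].
case: (eqVneq b a) => [eba|nba]; rewrite /outer.
  case: (eqVneq a m) => [->|_]; first by rewrite !(eq_sym m) ordS_neq ord_pred_neq.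
  (* The vertex maa with [a != m] sees amm, which has value 1 exactly when a = m-1. As a = m+1 is
     excluded by the zero value, this is exactly when clique [a] has weight 1. *)
  have eq_pred : (m == ordS a) = (a == ord_pred m).
    by rewrite eq_sym (can2_eq (@ordSK n) (@ord_predK n)).
  have eq_succ : (m == ord_pred a) = (a == ordS m).
    by rewrite eq_sym (can2_eq (@ord_predK n) (@ordSK n)).
  rewrite /= /cyclic_pattern eq_pred eq_succ -eba (negPf nbS) andbT orbF.
  by case: (b == ord_pred m).
(* If clique [a] has weight 1, then mba has value 1: always for a = m+1, and for a = m-1 because [b]
   is neither m-1 nor m+1. *)
rewrite /cyclic_pattern nbS andbT; case: (eqVneq a (ordS m)) => [_|_]; rewrite ?andbF //=.
by case: (eqVneq a (ord_pred m)) => [<-|]; rewrite ?nba.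
Qed.

End UpperBound.

Theorem theorem4p1 (n t : nat) (hn : 3 <= n) (ht : 2 <= t) :
  perfect_italian_number (@sierpinski n t) =
    if t == 2 then 2 * n - 1 else n ^ (t - 2) * (2 * n - 2).
Proof.
case: t ht => [|[|t]] // _; rewrite subSS subSS subn0.
have [[f /italian_perfect fP fmin] _] := perfect_italian_numberP (@sierpinski n t.+2).
have n_gt0 : 0 < n by apply: leq_trans hn.
apply/eqP; rewrite eqn_leq -{2}fmin /weight.
case: t f fP {fmin} => [|t] f fP /=.
  rewrite (sierpinski2_upper (Ordinal n_gt0)) big_tuple2.
  exact: block_weight_isolated (italian_block fP) n_gt0 _.
apply/andP; split.
  rewrite -last_three_weight //; apply: perfect_italian_number_le => [u|].
    exact: leq_trans (leq_b1 _) _.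
  exact: last_three_italian.
have f_le2 u : f u <= 2 by rewrite -ltnS.
have := italian_weight hn f_le2 fP.
(* Nothing lies outside the whole graph, so no extreme vertex sees a value 1; the right-hand
   correction vanishes and the factor 3 cancels. *)
have -> : extreme_count 0 1 (fun u => f u : nat) (fun=> 0) = 0.
  by apply: big1 => k _; rewrite andbF.
by rewrite muln0 addn0 => /(leq_trans (leq_addr _ _)); rewrite leq_mul2l.
Qed.
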